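(* Let $R_\times=R(\mathbb F_2^2,\{x,y\})$, where $x,y$ are the two coordinate linear forms on $\mathbb F_2^2$. There is a family of $n$-vertex $3$-graphs $G_\alpha(n)$, indexed by $\alpha\in(0,1/2)$ and $n\in\mathbb N$, each a blowup of $R_\times$, such that \[|G_\alpha(n)|=\left(\tfrac1{27}+o(1)\right)n^3=\left(\tfrac29+o(1)\right)\binom n3,\] and for every distinct $\alpha,\beta\in(0,1/2)$, $\mathrm{dist}(G_\alpha(n),G_\beta(n))=\Omega_{\alpha,\beta}(n^3)$ as $n\to\infty$.
   Context: For a finite-dimensional $\mathbb F_2$-vector space $U$ and a set $\mathcal C$ of nonzero linear forms on $U$, the cut template $R(U,\mathcal C)$ is the $3$-graph with vertex set $\{a_c:c\in\mathcal C\}\sqcup U$ whose edges are exactly the triples $\{a_c,u,v\}$ with $c\in\mathcal C$, $u,v\in U$ distinct, and $c(u+v)=1$. For a $3$-graph $G$ on $[m]$ and pairwise disjoint (possibly empty) sets $V_1,\dots,V_m$, the blowup $G[V_1,\dots,V_m]$ has vertex set $\bigcup V_i$ and edges all triples $\{x,y,z\}$ with $x\in V_i,y\in V_j,z\in V_k$ for some $ijk\in G$. $|H|$ denotes the number of edges. For $3$-graphs $G,H$ on the same number of vertices, $\mathrm{dist}(G,H)=\min_{\psi}|\psi(G)\triangle H|$, the minimum over bijections $\psi:V(G)\to V(H)$. *)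

(* Defs.v *)
From HB Require Import structures.
From mathcomp Require Import all_boot fingroup perm all_algebra all_field.

Set Implicit Arguments.
Unset Strict Implicit.
Unset Printing Implicit Defensive.

Import GRing.Theory.
Local Open Scope ring_scope.

Record graph3 (V : finType) := Graph3 {
  edges : {set {set V}};
  edges_card3 : {in edges, forall e : {set V}, #|e| = 3%N}
}.

Section CutTemplate.
Variable U : vectType 'F_2.

(* [finvect_type] only equips its argument with its finite-type structure. *)
Definition linform := finvect_type 'Hom(U, ('F_2)^o).

Variable C : {set linform}.

(* [inl c] is the vertex a_c, [inr u] is the vertex u of U. *)
Definition cut_vertex : finType := ({c | c \in C} + finvect_type U)%type.

Definition cut_edges : {set {set cut_vertex}} :=
  [set e | [exists c : {c | c \in C}, exists u : finvect_type U,
            exists v : finvect_type U,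
     [&& u != v, (val c : 'Hom(U, ('F_2)^o)) (u + v) == 1
       & e == [set inl c; inr u; inr v]]]].

Lemma cut_edges_card3 : {in cut_edges, forall e : {set cut_vertex}, #|e| = 3%N}.
Proof.
move=> e; rewrite inE => /existsP[c /existsP[u /existsP[v /and3P[uv _ /eqP->]]]].
have uv' : (inr u : cut_vertex) != inr v by apply: contra uv => /eqP[->].
rewrite -setUA cardsU1 !inE cards2 uv'.
by rewrite (_ : (inl c == inr u) = false) // (_ : (inl c == inr v) = false).
Qed.

(* [C] is meant to consist of nonzero forms; a zero form would only contribute
   an isolated vertex. *)
Definition cut_template : graph3 cut_vertex := Graph3 cut_edges_card3.
End CutTemplate.

Definition coordinate (i : 'I_2) (u : 'rV['F_2]_2) : ('F_2)^o := u ord0 i.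

Fact coordinate_is_linear i : linear (coordinate i).
Proof. by move=> a u v; rewrite /coordinate !mxE. Qed.

HB.instance Definition _ i :=
  GRing.isLinear.Build 'F_2 'rV['F_2]_2 ('F_2)^o *:%R (coordinate i)
    (coordinate_is_linear i).

Definition coordinate_form (i : 'I_2) : linform 'rV['F_2]_2 :=
  linfun (coordinate i).

Fact coordinate_formE i (u : 'rV['F_2]_2) :
  (coordinate_form i : 'Hom('rV['F_2]_2, ('F_2)^o)) u = u ord0 i.
Proof. by rewrite lfunE. Qed.

Definition coordinate_forms : {set linform 'rV['F_2]_2} :=
  [set coordinate_form ord0; coordinate_form ord_max].

Fact coordinate_forms_neq0 (c : 'Hom('rV['F_2]_2, ('F_2)^o)) :
  (c : linform _) \in coordinate_forms -> c != 0.
Proof.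
have nz i : (coordinate_form i : 'Hom('rV['F_2]_2, ('F_2)^o)) != 0.
  apply/eqP => /lfunP/(_ (delta_mx ord0 i)) /eqP.
  by rewrite coordinate_formE zero_lfunE mxE !eqxx.
by rewrite !inE => /orP[] /eqP ->; apply: nz.
Qed.

Definition R_times := cut_template coordinate_forms.

Section Blowup.
Variables I T : finType.

Definition blowup_edges (G : graph3 I) (P : I -> {set T}) : {set {set T}} :=
  [set e | [exists i, exists j, exists k, exists x in P i, exists y in P j,
            exists z in P k,
     ([set i; j; k] \in edges G) && (e == [set x; y; z])]].

(* [H], whose vertex set is all of [T], is a blowup of [G]. *)
Definition is_blowup (G : graph3 I) (H : graph3 T) : Prop :=
  exists P : I -> {set T},
    [/\ forall i j, i != j -> [disjoint P i & P j],
        \bigcup_i P i = [set: T]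
      & edges H = blowup_edges G P].
End Blowup.

Section Distance.
Variable V : finType.

Definition symdiff (T : finType) (A B : {set T}) : {set T} :=
  (A :\: B) :|: (B :\: A).

Definition mismatch (G H : graph3 V) (s : {perm V}) : nat :=
  #|symdiff [set s @: e | e : {set V} in edges G] (edges H)|.

(* The default value of the minimum is the value at the identity, so it does
   not affect the result. *)
Definition dist3 (G H : graph3 V) : nat :=
  \big[minn/mismatch G H 1%g]_(s : {perm V}) mismatch G H s.
End Distance.

(* Main.v *)
(* The template has a whole family of optimal weightings: give a_x and a_y
   weights p and q with p + q = 1/3, give 00 and 11 weight t and give 01 and 10
   weight s with t + s = 1/3.  Every such blowup has (p + q) (t + s)^2 n^3
   edges, and even all its degrees agree.  The codegrees do depend on p: the sum
   of the squared codegrees is constant - 8 t s p q (times n^4).  This sum is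
   invariant under isomorphism and changes by O(n) when one edge is edited, so
   two values of it at distance c n^4 force edit distance at least c' n^3.  The
   graphs below have t = s and p = alpha / 3, up to rounding; p q is strictly
   increasing in alpha on (0, 1/2). *)

Require Import Defs.
From mathcomp Require Import all_boot all_order fingroup perm all_algebra all_field.
From mathcomp Require Import ring lra zify.

Set Implicit Arguments.
Unset Strict Implicit.
Unset Printing Implicit Defensive.
Import Order.TTheory GRing.Theory Num.Theory.

(** * Counting edges through ordered triples *)

Lemma imset_set3 (S T : finType) (f : S -> T) x y z :
  f @: [set x; y; z] = [set f x; f y; f z].
Proof. by rewrite !imsetU !imset_set1. Qed.

Lemma cards3E (T : finType) (x y z : T) :
  (#|[set x; y; z]| == 3) = [&& x != y, x != z & y != z].
Proof.
rewrite -setUA cardsU1 cards2 !inE negb_or.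
by case: (x == y); case: (x == z); case: (y == z).
Qed.

(** Only triples of distinct vertices form a 3-set; picking them one after another from [e] leaves
    3, 2 and then 1 choices. *)
Lemma sum_set3_eq (T : finType) (e : {set T}) : #|e| = 3 ->
  \sum_x \sum_y \sum_z ([set x; y; z] == e) = 6.
Proof.
move=> e3.
have eqE x y z : ([set x; y; z] == e) = [&& x \in e, y \in e :\ x & z \in e :\ x :\ y].
  apply/eqP/and3P => [def_e | [xe]].
    have : #|[set x; y; z]| == 3 by rewrite def_e e3.
    rewrite cards3E -def_e !inE !eqxx !orbT /= => /and3P[xy xz yz].
    by rewrite eq_sym xy eq_sym yz eq_sym xz.
  rewrite !inE => /andP[yx ye] /and3P[zy zx ze].
  apply/eqP; rewrite eqEcard e3 (eqP (_ : #|_| == 3)) ?leqnn ?andbT.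
    by apply/subsetP => w; rewrite !inE => /orP[/orP[]|] /eqP->.
  by rewrite cards3E eq_sym yx eq_sym zx eq_sym zy.
transitivity (\sum_(x in e) \sum_(y in e :\ x) #|e :\ x :\ y|).
  rewrite [RHS]big_mkcond; apply: eq_bigr => x _; case: ifP => xe; last first.
    by rewrite big1 // => y _; rewrite big1 // => z _; rewrite eqE xe.
  rewrite [RHS]big_mkcond; apply: eq_bigr => y _; case: ifP => ye; last first.
    by rewrite big1 // => z _; rewrite eqE ye andbF.
  by rewrite -sum1_card [RHS]big_mkcond; apply: eq_bigr => z _; rewrite eqE xe ye; case: ifP.
rewrite (eq_bigr (fun=> 2)) => [|x xe]; first by rewrite sum_nat_const e3.
have e2 : #|e :\ x| = 2.
  (* The added 1 is turned into the membership bit that [cardsD1] splits off. *)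
  by apply/eqP; rewrite -(eqn_add2l 1) -{1}[1]/(nat_of_bool true) -xe -cardsD1 e3.
rewrite (eq_bigr (fun=> 1)) ?sum_nat_const ?e2 // => y ye.
by apply/eqP; rewrite -(eqn_add2l 1) -{1}[1]/(nat_of_bool true) -ye -cardsD1 e2.
Qed.

(** Unlike a cardinality of edge sets, a sum over ordered triples of vertices can be evaluated class
    by class in a blowup. *)
Lemma sum_triples (T : finType) (A : {set {set T}}) :
  {in A, forall e : {set T}, #|e| = 3} ->
  \sum_x \sum_y \sum_z ([set x; y; z] \in A) = 6 * #|A|.
Proof.
move=> A3.
have mem_sum x y z : ([set x; y; z] \in A) = \sum_(e in A) ([set x; y; z] == e) :> nat.
  have [inA | notA] := boolP (_ \in A).
    by rewrite (bigD1 _ inA) /= eqxx big1 // => e /andP[_ /negPf]; rewrite eq_sym => ->.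
  by rewrite big1 // => e eA; apply/eqP; rewrite eqb0; apply: contraNneq notA => ->.
under eq_bigr => x _ do under eq_bigr => y _ do
  (under eq_bigr => z _ do rewrite mem_sum; rewrite exchange_big).
under eq_bigr => x _ do rewrite exchange_big.
by rewrite exchange_big (eq_bigr (fun=> 6)) => [|e /A3/sum_set3_eq //]; rewrite sum_nat_const mulnC.
Qed.

(** * Squared codegrees under relabelling and under edits *)

Section Cherries.
Variable T : finType.
Implicit Types A B : {set {set T}}.

(* [cherries A] is the sum of the squared codegrees over ordered pairs (x, y). *)
Definition cherries A : nat :=
  \sum_x \sum_y \sum_z \sum_w ([set x; y; z] \in A) * ([set x; y; w] \in A).

Lemma cherries_perm A (s : {perm T}) :
  cherries [set s @: e | e : {set T} in A] = cherries A.
Proof.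
have mem x y z : ([set s x; s y; s z] \in [set s @: e | e : {set T} in A])
    = ([set x; y; z] \in A).
  rewrite -imset_set3 mem_imset //; exact/imset_inj/perm_inj.
rewrite /cherries (reindex_inj (@perm_inj _ s)); apply: eq_bigr => x _.
rewrite (reindex_inj (@perm_inj _ s)); apply: eq_bigr => y _.
rewrite (reindex_inj (@perm_inj _ s)); apply: eq_bigr => z _.
by rewrite (reindex_inj (@perm_inj _ s)); apply: eq_bigr => w _; rewrite !mem.
Qed.

(** Termwise: if [A] contains both [[set x; y; z]] and [[set x; y; w]], then either [B] contains
    both or one of them lies in [symdiff A B]. Each set in the difference accounts for 6 ordered
    triples and [#|T|] choices of the fourth vertex, in each of two summands, hence the factor
    12. *)
Lemma leq_cherries A B :
  {in A, forall e : {set T}, #|e| = 3} -> {in B, forall e : {set T}, #|e| = 3} ->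
  cherries A <= cherries B + 12 * #|T| * #|symdiff A B|.
Proof.
move=> A3 B3; set D := symdiff A B.
have D3 : {in D, forall e : {set T}, #|e| = 3}.
  by move=> e; rewrite !inE => /orP[] /andP[_]; [apply: A3 | apply: B3].
pose f x y z : nat := [set x; y; z] \in D.
have sumf : \sum_x \sum_y \sum_z f x y z = 6 * #|D| by apply: sum_triples.
have -> : 12 * #|T| * #|D| = \sum_x \sum_y \sum_z \sum_w (f x y z + f x y w).
  under eq_bigr => x _.
    under eq_bigr => y _.
      under eq_bigr => z _ do rewrite big_split /= sum_nat_const.
      rewrite big_split /= -big_distrr sum_nat_const /= -mulnDr.
      over.
    rewrite -big_distrr big_split /=.
    over.
  rewrite -big_distrr big_split /= !sumf; ring.
rewrite /cherries -big_split; apply: leq_sum => x _.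
rewrite -big_split; apply: leq_sum => y _; rewrite -big_split; apply: leq_sum => z _.
rewrite -big_split; apply: leq_sum => w _ /=.
rewrite /f !inE; do 4!case: (_ \in _) => //.
Qed.

Lemma cherries_symdiff A B :
  {in A, forall e : {set T}, #|e| = 3} -> {in B, forall e : {set T}, #|e| = 3} ->
  cherries A <= cherries B + 12 * #|T| * #|symdiff A B| /\
  cherries B <= cherries A + 12 * #|T| * #|symdiff A B|.
Proof.
move=> A3 B3; split; first exact: leq_cherries.
by rewrite /symdiff setUC; apply: leq_cherries.
Qed.
End Cherries.

(** * Edit distance bounds the change of [cherries] *)

Lemma dist3_attained (V : finType) (G H : graph3 V) :
  exists s : {perm V}, dist3 G H = mismatch G H s.
Proof.
rewrite /dist3; elim/big_ind: _ => [|m n [s ->] [t ->] | s _]; first by exists 1%g.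
  by have [_|_] := leqP (mismatch G H s); [exists s | exists t].
by exists s.
Qed.

Lemma cherries_dist3 (V : finType) (G H : graph3 V) :
  cherries (edges G) <= cherries (edges H) + 12 * #|V| * dist3 G H /\
  cherries (edges H) <= cherries (edges G) + 12 * #|V| * dist3 G H.
Proof.
have [s ->] := dist3_attained G H.
rewrite -(cherries_perm (edges G) s); apply: cherries_symdiff; last exact: edges_card3.
by move=> _ /imsetP[e eG ->]; rewrite (card_imset _ (@perm_inj _ s)) (edges_card3 eG).
Qed.

(** * Blowups whose parts are the fibers of a map *)

Section BlowupAlong.
Variables (I T : finType) (G : graph3 I) (f : T -> I).

Definition fiber i : {set T} := [set x | f x == i].

Lemma mem_blowup_fiber x y z :
  ([set x; y; z] \in blowup_edges G fiber) = ([set f x; f y; f z] \in edges G).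
Proof.
rewrite inE; apply/existsP/idP => [[i /existsP[j /existsP[k]]] | fG].
  case/exists_inP=> x'; rewrite inE => /eqP<-.
  case/exists_inP=> y'; rewrite inE => /eqP<-.
  case/exists_inP=> z'; rewrite inE => /eqP<-.
  by case/andP=> fG /eqP def; rewrite -imset_set3 def imset_set3.
exists (f x); apply/existsP; exists (f y); apply/existsP; exists (f z).
apply/exists_inP; exists x; first by rewrite inE.
apply/exists_inP; exists y; first by rewrite inE.
by apply/exists_inP; exists z; rewrite ?inE // fG eqxx.
Qed.

(** The images under [f] form a template edge, so they are distinct, and then so are the vertices
    above them. *)
Lemma blowup_fiber_card3 :
  {in blowup_edges G fiber, forall e : {set T}, #|e| = 3}.
Proof.
move=> e eB; have [x [y [z def_e]]] : exists x y z, e = [set x; y; z].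
  move: eB; rewrite inE => /existsP[i /existsP[j /existsP[k]]].
  by case/exists_inP=> x _ /exists_inP[y _ /exists_inP[z _ /andP[_ /eqP->]]]; exists x, y, z.
apply/eqP; move: eB; rewrite def_e mem_blowup_fiber => /edges_card3/eqP.
rewrite !cards3E => /and3P[xy xz yz].
by apply/and3P; split; [apply: contraNneq xy | apply: contraNneq xz | apply: contraNneq yz] => ->.
Qed.

Definition blowup_along : graph3 T := Graph3 blowup_fiber_card3.

Lemma is_blowup_along : is_blowup G blowup_along.
Proof.
exists fiber; split=> // [i j ij|].
  by apply/pred0P => x; rewrite /= !inE; apply: contraNF ij => /andP[/eqP<- /eqP<-].
by apply/setP => x; rewrite !inE; apply/bigcupP; exists (f x); rewrite ?inE.
Qed.
End BlowupAlong.

(** * Splitting ['I_n] into classes of prescribed sizes *)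

Section Composition.
Variables (K : finType) (size : K -> nat) (n : nat).
Hypothesis size_sum : \sum_k size k = n.

Fact card_parts : #|{: {k : K & 'I_(size k)}}| = n.
Proof.
rewrite -size_sum card_tagged sumnE big_map big_enum.
by apply: eq_bigr => k _; rewrite card_ord.
Qed.

(** Enumerating the sigma type identifies ['I_n] with the disjoint union of the classes; the tag is
    the class. *)
Definition part (x : 'I_n) : K := tag (enum_val (cast_ord (esym card_parts) x)).

Lemma sum_part (F : K -> nat) : \sum_x F (part x) = \sum_k size k * F k.
Proof.
rewrite (reindex (fun u : {k : K & 'I_(size k)} =>
  cast_ord card_parts (enum_rank u))) /=; last first.
  exists (fun x => enum_val (cast_ord (esym card_parts) x)) => x _.
    by rewrite cast_ordK enum_rankK.
  by rewrite enum_valK cast_ordKV.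
under eq_bigr => u _ do rewrite /part cast_ordK enum_rankK.
rewrite -(@sig_big_dep _ _ _ _ (fun k => 'I_(size k) : finType) xpredT (fun=> xpredT)
  (fun k _ => F k)) /=.
by apply: eq_bigr => k _; rewrite sum_nat_const card_ord.
Qed.
End Composition.

(** * A Boolean model of [R_times] and its weighted counts *)

(* [inl false] and [inl true] stand for a_x and a_y, [inr (x, y)] for the vertex
   (x, y) of U. *)
Definition type6 : finType := (bool + bool * bool)%type.

Definition proj (b : bool) (u : bool * bool) : bool := if b then u.2 else u.1.

Definition edge6 (i j k : type6) : bool :=
  match i, j, k with
  | inl b, inr u, inr v | inr u, inl b, inr v | inr u, inr v, inl b =>
      proj b u != proj b v
  | _, _, _ => false
  end.

Definition size6 (p q t s : nat) (k : type6) : nat :=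
  match k with
  | inl b => if b then q else p
  | inr (x, y) => if x == y then t else s
  end.

Lemma sum_type6 (F : type6 -> nat) : \sum_k F k =
  F (inl false) + F (inl true) + (F (inr (false, false)) + F (inr (false, true))
    + F (inr (true, false)) + F (inr (true, true))).
Proof.
rewrite big_sumType /= big_bool.
have -> : \sum_u F (inr u) = \sum_x \sum_y F (inr (x, y)).
  by rewrite pair_big; apply: eq_bigr => -[].
by rewrite !big_bool /=; ring.
Qed.

(** Each of the two forms cuts the four vectors into halves of weight [t + s]; the 6 counts
    orderings. *)
Lemma edge_count6 p q t s (S := size6 p q t s) :
  \sum_i S i * \sum_j S j * \sum_k S k * edge6 i j k = 6 * ((p + q) * (t + s) ^ 2).
Proof. rewrite !sum_type6 /S /= /proj /=; ring. Qed.

(** A form and a vector have codegree [h]. Two vectors have codegree [p + q] if they differ in both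
    coordinates, and [p] or [q] if they differ in one; the latter pairs have total weight
    [8 * t * s], shared equally, and [p ^ 2 + q ^ 2 = (p + q) ^ 2 - 2 * p * q] yields the
    correction. It stands on the left to avoid truncated subtraction. *)
Lemma cherry_count6 p q t s (S := size6 p q t s) (h := t + s) :
  \sum_i S i * \sum_j S j * (\sum_k S k * edge6 i j k) ^ 2 + 8 * (t * s * (p * q)) =
  4 * (p + q) * h ^ 3 + 2 * h ^ 2 * (p + q) ^ 2.
Proof. rewrite !sum_type6 /S /h /= /proj /=; ring. Qed.

Definition coord (b : bool) : 'I_2 := if b then ord_max else ord0.

Fact coordinate_form_in b : coordinate_form (coord b) \in coordinate_forms.
Proof. by rewrite !inE; case: b; rewrite eqxx ?orbT. Qed.

Definition vec (u : bool * bool) : finvect_type 'rV['F_2]_2 :=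
  (\row_j (proj (val j == 1%N) u)%:R)%R.

Definition vertex6 (k : type6) : cut_vertex coordinate_forms :=
  match k with
  | inl b => inl (exist _ (coordinate_form (coord b)) (coordinate_form_in b))
  | inr u => inr (vec u)
  end.

(** * Edges of cut templates, and agreement of [R_times] with [edge6] *)

Section CutEdges.
Variables (U : vectType 'F_2) (C : {set linform U}).
Implicit Types (c d : {c | c \in C}) (u v w : finvect_type U).

Lemma mem_cut_edges c u v :
  ([set inl c; inr u; inr v] \in cut_edges C) =
  ((val c : 'Hom(U, ('F_2)^o)) (u + v)%R == 1%R).
Proof.
rewrite inE; apply/existsP/idP => [[c' /existsP[u' /existsP[v']]] | cuv].
  case/and3P=> uv' cuv' /eqP/setP def.
  have := def (inl c); rewrite !inE eqxx /= !orbF => /esym/eqP[->].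
  have := def (inr u'); have := def (inr v'); rewrite !inE !eqxx !orbT /=.
  case/orP=> /eqP[v'E] /orP[] /eqP[u'E]; rewrite v'E u'E ?eqxx // in uv' cuv' *.
  by rewrite addrC.
exists c; apply/existsP; exists u; apply/existsP; exists v; rewrite cuv eqxx !andbT.
(* Distinctness comes for free: in characteristic 2, [v + v = 0], where a form cannot take the value
   1. *)
apply: contraTneq cuv => ->.
rewrite (_ : (v + v = 0)%R) ?linear0 1?eq_sym ?oner_eq0 //.
by rewrite -[v in LHS]scale1r -scalerDl (_ : (1 + 1 = 0)%R) ?scale0r //; apply/val_inj.
Qed.

(** An edge has two distinct vectors, but here both would have to be [x]. *)
Lemma two_forms_notin c d x : [set inl c; inl d; x] \notin cut_edges C.
Proof.
rewrite inE; apply/negP => /existsP[c' /existsP[u /existsP[v]]].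
case/and3P=> uv _ /eqP/setP def.
have := def (inr u); have := def (inr v); rewrite !inE !eqxx !orbT /=.
by move=> /eqP vx /eqP; rewrite -vx => -[uv']; rewrite uv' eqxx in uv.
Qed.

Lemma three_vectors_notin u v w : [set inr u; inr v; inr w] \notin cut_edges C.
Proof.
rewrite inE; apply/negP => /existsP[c /existsP[u' /existsP[v']]].
by case/and3P=> _ _ /eqP/setP/(_ (inl c)); rewrite !inE eqxx.
Qed.
End CutEdges.

Lemma set3_rot (T : finType) (x y z : T) : [set x; y; z] = [set y; z; x].
Proof. by rewrite -setUA setUC. Qed.

Lemma set3_swap (T : finType) (x y z : T) : [set x; y; z] = [set y; x; z].
Proof. by rewrite (setUC [set x]). Qed.

Lemma mem_vertex6 b u v :
  ([set vertex6 (inl b); vertex6 (inr u); vertex6 (inr v)] \in edges R_times) =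
  (proj b u != proj b v).
Proof.
rewrite mem_cut_edges /= coordinate_formE !mxE.
by case: b; case: (proj _ u); case: (proj _ v).
Qed.

Lemma mem_edge6 i j k :
  ([set vertex6 i; vertex6 j; vertex6 k] \in edges R_times) = edge6 i j k.
Proof.
case: i j k => [b|u] [c|v] [d|w]; rewrite /edge6.
- exact/negbTE/two_forms_notin.
- exact/negbTE/two_forms_notin.
- rewrite set3_rot set3_rot; exact/negbTE/two_forms_notin.
- exact: mem_vertex6.
- rewrite set3_rot; exact/negbTE/two_forms_notin.
- by rewrite set3_swap mem_vertex6.
- by rewrite set3_rot set3_rot mem_vertex6.
- exact/negbTE/three_vectors_notin.
Qed.

(** * The graphs and their exact counts *)

Section TimesGraph.
Variables n p : nat.

(** The vectors receive exactly [2 * third] vertices, so that every form cuts them into halves of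
    size [third]; the remainder of [n] modulo 3 goes to the forms, through [cut_part]. *)
Definition third := n %/ 3.
Definition cut_part := n - 2 * third.
(* [minn] matters only for p > cut_part, where it keeps the total equal to n. *)
Definition sizes : type6 -> nat :=
  size6 (minn p cut_part) (cut_part - p) third./2 (third - third./2).

Lemma half_third : third./2 + (third - third./2) = third.
Proof. by rewrite subnKC // -divn2 leq_div. Qed.

Lemma cut_part_split : minn p cut_part + (cut_part - p) = cut_part.
Proof. by have [p_le|/ltnW/eqP->] := leqP p cut_part; rewrite ?subnKC ?addn0. Qed.

Lemma sizes_sum : \sum_k sizes k = n.
Proof.
rewrite sum_type6 /=. have := half_third; have := cut_part_split; rewrite /cut_part /third; lia.
Qed.

Definition times_graph : graph3 'I_n :=
  blowup_along R_times (vertex6 \o part sizes_sum).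

Lemma mem_times_graph x y z : ([set x; y; z] \in edges times_graph) =
  edge6 (part sizes_sum x) (part sizes_sum y) (part sizes_sum z).
Proof. by rewrite mem_blowup_fiber mem_edge6. Qed.

Lemma card_times_graph : #|edges times_graph| = cut_part * third ^ 2.
Proof.
apply/eqP; rewrite -(eqn_pmul2l (isT : 0 < 6)); apply/eqP.
rewrite -sum_triples; last exact: edges_card3.
under eq_bigr => x _ do under eq_bigr => y _ do under eq_bigr => z _ do rewrite mem_times_graph.
under eq_bigr => x _ do (under eq_bigr => y _ do rewrite (sum_part _ (fun k => edge6 _ _ k));
  rewrite (sum_part _ (fun j => \sum_k _ * edge6 _ j k))).
rewrite (sum_part _ (fun i => \sum_j _ * \sum_k _ * edge6 i j k)).
by rewrite edge_count6 half_third cut_part_split.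
Qed.

Lemma cherries_times_graph : p <= cut_part ->
  cherries (edges times_graph) +
    8 * (third./2 * (third - third./2) * (p * (cut_part - p))) =
  4 * cut_part * third ^ 3 + 2 * third ^ 2 * cut_part ^ 2.
Proof.
move=> /minn_idPl p_le.
have := cherry_count6 (minn p cut_part) (cut_part - p) third./2 (third - third./2).
rewrite /= half_third cut_part_split -/sizes p_le => <-; congr (_ + _); rewrite /cherries.
(* For fixed [x] and [y] the sums over [z] and [w] separate, and their product is a squared
   codegree. *)
under eq_bigr => x _.
  under eq_bigr => y _.
    under eq_bigr => z _.
      under eq_bigr => w _ do rewrite !mem_times_graph.
      rewrite -big_distrr (sum_part _ (fun k => edge6 _ _ k)).
      over.
    rewrite -big_distrl /= (sum_part _ (fun k => edge6 _ _ k)).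
    over.
  rewrite (sum_part _ (fun j => (\sum_k sizes k * edge6 _ j k) * (\sum_k sizes k * edge6 _ j k))).
  over.
rewrite (sum_part _ (fun i => \sum_j sizes j *
  ((\sum_k sizes k * edge6 i j k) * (\sum_k sizes k * edge6 i j k)))).
by under eq_bigr => i _ do under eq_bigr => j _ do rewrite mulnn.
Qed.
End TimesGraph.

(* Real estimates and asymptotics *)
From mathcomp Require Import all_classical all_reals all_analysis.
Import numFieldNormedType.Exports.
Local Open Scope classical_set_scope.
Local Open Scope ring_scope.

(** The difference factors through [y * (A - y) - x * (A - x) = (y - x) * (A - x - y)], and every
    factor is bounded below linearly in [N]; 1/324 is 8/(12 * 12 * 6 * 3). *)
Lemma cut_product_gap (F : realFieldType) (N T S A x y alpha beta : F) :
  0 <= N -> N / 12 <= T -> N / 12 <= S -> N / 3 <= A ->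
  x <= alpha * A -> beta * A - 1 <= y -> y <= beta * A ->
  6 <= N * (beta - alpha) -> 0 < beta - alpha -> 0 < 1 - alpha - beta ->
  (beta - alpha) * (1 - alpha - beta) / 324 * N ^+ 4 <=
    8 * (T * S * (y * (A - y))) - 8 * (T * S * (x * (A - x))).
Proof.
move=> N0 NT NS NA xA Ay yA large d0 e0.
have N12 : 0 <= N / 12 by lra.
have TS : (N / 12) * (N / 12) <= T * S by apply: ler_pM.
(* Half of [(beta - alpha) * N / 3] is given up to absorb the rounding error 1. *)
have yx : (beta - alpha) * N / 6 <= y - x.
  have : (beta - alpha) * (N / 3) <= (beta - alpha) * A by rewrite ler_pM2l.
  lra.
have Axy : (1 - alpha - beta) * N / 3 <= A - x - y.
  have : (1 - alpha - beta) * (N / 3) <= (1 - alpha - beta) * A by rewrite ler_pM2l.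
  lra.
have dN : 0 <= (beta - alpha) * N / 6 by rewrite divr_ge0 ?mulr_ge0 ?(ltW d0).
have eN : 0 <= (1 - alpha - beta) * N / 3 by rewrite divr_ge0 ?mulr_ge0 ?(ltW e0).
have := ler_pM (mulr_ge0 N12 N12) (mulr_ge0 dN eN) TS (ler_pM dN eN yx Axy).
have -> : T * S * ((y - x) * (A - x - y)) =
    T * S * (y * (A - y)) - T * S * (x * (A - x)) by ring.
have -> : N / 12 * (N / 12) * ((beta - alpha) * N / 6 * ((1 - alpha - beta) * N / 3))
  = (beta - alpha) * (1 - alpha - beta) / 324 * N ^+ 4 / 8 by field.
lra.
Qed.

Section Estimates.
Variable R : realType.
Implicit Types (n : nat) (alpha beta eps : R).

Lemma bin3E n : 'C(n, 3)%:R = n%:R * (n%:R - 1) * (n%:R - 2) / 6 :> R.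
Proof.
have : 6%N%:R * 'C(n, 3)%:R = n%:R * (n%:R - 1) * (n%:R - 2) :> R.
  rewrite -natrM mulnC -[6%N]/(3`!)%N bin_ffact !ffactnS ffactn0 muln1.
  case: n => [|[|[|n]]] /=; rewrite ?mul0r ?mul0n ?muln0 ?subrr ?mulr0 ?mul0r //.
  rewrite !natrM -!natr1; ring.
by move=> <-; field.
Qed.

(** With [n = 3 * h + r] the count is [(h + r) * h ^ 2], which matches the two leading terms of
    [N ^ 3 / 27]; passing to the binomial costs about [N ^ 2 / 9]. The bound does not involve [p],
    so it is uniform in alpha. *)
Lemma card_times_graph_error n p (N := n%:R : R) (E := #|edges (times_graph n p)|%:R : R) :
  `|E - 1 / 27 * N ^+ 3| <= N ^+ 2 /\ `|E - 2 / 9 * 'C(n, 3)%:R| <= N ^+ 2.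
Proof.
rewrite /E card_times_graph natrM natrX bin3E -/N.
have [r r3 [nE aE]] : exists2 r, (r < 3)%N &
    n = (third n * 3 + r)%N /\ cut_part n = (third n + r)%N.
  exists (n %% 3)%N; first by rewrite ltn_mod.
  by rewrite /cut_part /third; lia.
have -> : N = (third n)%:R * 3 + r%:R by rewrite -natrM -natrD -nE.
rewrite aE natrD; have h0 : 0 <= (third n)%:R :> R by [].
(* Integrality gives this; with it, linear terms are dominated by quadratic ones. *)
have : (third n)%:R <= (third n)%:R ^+ 2 :> R.
  by rewrite -natrX ler_nat; case: (third n) => // h; rewrite -mulnn leq_pmulr.
move: (third n)%:R h0 => h h0 h_le_sqr.
by case: r r3 {nE aE N E} => [|[|[|//]]] _; split; rewrite ler_norml; apply/andP; split; lra.
Qed.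

Definition cut_size alpha n : nat := Num.trunc (alpha * (cut_part n)%:R).

Lemma cut_size_le alpha n : 0 < alpha < 1 / 2 -> (cut_size alpha n <= cut_part n)%N.
Proof.
case/andP=> a0 a1; rewrite /cut_size truncn_le_nat -natr1.
have : 0 <= (cut_part n)%:R :> R by []. nra.
Qed.

Lemma cut_size_itv alpha n (a := (cut_part n)%:R : R) : 0 < alpha ->
  alpha * a - 1 <= (cut_size alpha n)%:R <= alpha * a.
Proof.
move=> alpha0; have /truncn_itv : 0 <= alpha * a by rewrite mulr_ge0 // ltW.
by rewrite -natr1 -/(cut_size _ _) lerBlDr => /andP[-> /ltW ->].
Qed.

(** The first two sizes are about [N / 6]; asking for half of that absorbs both roundings. *)
Lemma part_sizes_ge n (N := n%:R : R) : (10 <= n)%N ->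
  [/\ N / 12 <= (third n)./2%:R, N / 12 <= (third n - (third n)./2)%:R
    & N / 3 <= (cut_part n)%:R].
Proof.
have n_gt0 m : 0 < m.+1%:R :> R by [].
move=> n10; rewrite !ler_pdivrMr ?n_gt0 // -!natrM !ler_nat /cut_part /third.
by clear -n10; split; lia.
Qed.

Lemma times_graph_gap alpha beta : 0 < alpha -> alpha < beta -> beta < 1 / 2 ->
  exists2 k, 0 < k & \forall n \near \oo,
    (cherries (edges (times_graph n (cut_size beta n))))%:R + k * n%:R ^+ 4 <=
    (cherries (edges (times_graph n (cut_size alpha n))))%:R :> R.
Proof.
move=> a0 ab b1; have d0 : 0 < beta - alpha by rewrite subr_gt0.
have e0 : 0 < 1 - alpha - beta by lra.
exists ((beta - alpha) * (1 - alpha - beta) / 324).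
  by rewrite divr_gt0 ?mulr_gt0 ?ltr0n.
near=> n.
have ha : 0 < alpha < 1 / 2 by apply/andP; split; lra.
have hb : 0 < beta < 1 / 2 by apply/andP; split; lra.
have := cherries_times_graph (cut_size_le n hb).
have := cherries_times_graph (cut_size_le n ha).
(* Abstracting the cherry counts keeps the arithmetic tactics from trying to
   evaluate them as numerals. *)
generalize (cherries (edges (times_graph n (cut_size alpha n))))
  (cherries (edges (times_graph n (cut_size beta n)))) => Fa Fb <-.
move/(congr1 (fun m => m%:R : R)); rewrite !natrD !natrM !(natrB _ (cut_size_le n _)) // => gap.
have n10 : (10 <= n)%N by near: n; exact: nbhs_infty_ge.
have [tn sn an] := part_sizes_ge n10.
have nlarge : 6 / (beta - alpha) <= n%:R by near: n; exact: nbhs_infty_ger.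
rewrite ler_pdivrMr // in nlarge.
have /andP[_ xa] := cut_size_itv n a0.
have /andP[yb yb'] := cut_size_itv n (lt_trans a0 ab).
have N0 : 0 <= n%:R :> R by [].
move: gap tn sn an xa yb yb' nlarge N0.
move: n%:R (third n)./2%:R (third n - _)%:R (cut_part n)%:R (cut_size _ n)%:R (cut_size _ n)%:R.
move=> N T S A x y gap tn sn an xa yb yb' nlarge N0.
have := cut_product_gap N0 tn sn an xa yb yb' nlarge d0 e0.
by move: gap; clear; lra.
Unshelve. all: by end_near.
Qed.

Lemma times_graph_dist3 alpha beta : 0 < alpha < 1 / 2 -> 0 < beta < 1 / 2 -> alpha != beta ->
  exists2 k, 0 < k & \forall n \near \oo, k * n%:R ^+ 3 <=
    (dist3 (times_graph n (cut_size alpha n)) (times_graph n (cut_size beta n)))%:R :> R.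
Proof.
move=> /andP[a0 a1] /andP[b0 b1].
(* A gap of order [n ^ 4] is divided by the cost [12 * n] of one edit. *)
have bound k n (D x y : nat) : (0 < n)%N -> x%:R + k * n%:R ^+ 4 <= y%:R :> R ->
    (y <= x + 12 * n * D)%N -> k / 12 * n%:R ^+ 3 <= D%:R.
  move=> n0 gap; rewrite -(ler_nat R) natrD !natrM => le_yx.
  have n0R : 0 < n%:R :> R by rewrite ltr0n.
  rewrite -(ler_pM2l n0R); have -> : n%:R * (k / 12 * n%:R ^+ 3) = k * n%:R ^+ 4 / 12 by field.
  lra.
have dist_bounds n := cherries_dist3 (times_graph n (cut_size alpha n))
  (times_graph n (cut_size beta n)).
(* The smaller parameter has more cherries, so the two orders use opposite halves of
   [cherries_dist3]. *)
rewrite neq_lt => /orP[ab|ba].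
  have [k k0 gap] := times_graph_gap a0 ab b1.
  exists (k / 12); first by rewrite divr_gt0.
  near=> n; apply: (bound k _ _ _ _ _ (near gap n _)) => //; first by near: n; exact: nbhs_infty_gt.
  by have := dist_bounds n; rewrite card_ord => -[].
have [k k0 gap] := times_graph_gap b0 ba a1.
exists (k / 12); first by rewrite divr_gt0.
near=> n; apply: (bound k _ _ _ _ _ (near gap n _)) => //; first by near: n; exact: nbhs_infty_gt.
by have := dist_bounds n; rewrite card_ord => -[].
Unshelve. all: by end_near.
Qed.
End Estimates.

Theorem theorem4p5 (R : realType) :
  exists G : R -> forall n : nat, graph3 'I_n,
    [/\ forall (alpha : R) (n : nat), 0 < alpha < 1 / 2 ->
          is_blowup R_times (G alpha n),
        forall eps : R, 0 < eps -> \forall n \near \oo,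
          forall alpha : R, 0 < alpha < 1 / 2 ->
            `| #|edges (G alpha n)|%:R - 1 / 27 * n%:R ^+ 3 |
              <= eps * n%:R ^+ 3,
        forall eps : R, 0 < eps -> \forall n \near \oo,
          forall alpha : R, 0 < alpha < 1 / 2 ->
            `| #|edges (G alpha n)|%:R - 2 / 9 * 'C(n, 3)%:R |
              <= eps * 'C(n, 3)%:R
      & forall alpha beta : R,
          0 < alpha < 1 / 2 -> 0 < beta < 1 / 2 -> alpha != beta ->
          (fun n : nat => (dist3 (G alpha n) (G beta n))%:R : R^o)
            \is 'Omega_\oo (fun n : nat => n%:R ^+ 3 : R^o)].
Proof.
exists (fun alpha n => times_graph n (cut_size alpha n)); split.
- by move=> alpha n _; apply: is_blowup_along.
- move=> eps eps0; near=> n => alpha _.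
  apply: le_trans (card_times_graph_error R n (cut_size alpha n)).1 _.
  have : 1 / eps <= n%:R by near: n; exact: nbhs_infty_ger.
  rewrite ler_pdivrMr // => large; rewrite [_ ^+ 3]exprSr mulrCA [eps * _]mulrC.
  by apply: ler_peMr; rewrite ?exprn_ge0.
- move=> eps eps0; near=> n => alpha _.
  apply: le_trans (card_times_graph_error R n (cut_size alpha n)).2 _.
  (* From [N = 4] on, the binomial is at least [N ^ 3 / 24], so this threshold makes [eps] times it
     exceed the error [N ^ 2]. *)
  have : 24 / eps <= n%:R by near: n; exact: nbhs_infty_ger.
  have : 4%:R <= n%:R :> R by near: n; exact: nbhs_infty_ger.
  rewrite ler_pdivrMr // bin3E; move: n%:R => N N4 large.
  have cubic : N ^+ 2 * (N / 24) <= N * (N - 1) * (N - 2) / 6.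
    have -> : N * (N - 1) * (N - 2) / 6 = N * ((N - 1) * (N - 2) / 6) by ring.
    have -> : N ^+ 2 * (N / 24) = N * (N ^+ 2 / 24) by ring.
    rewrite ler_pM2l; nra.
  apply: le_trans (ler_wpM2l (ltW eps0) cubic).
  have -> : eps * (N ^+ 2 * (N / 24)) = N ^+ 2 * (N * eps / 24) by ring.
  apply: ler_peMr; first exact: sqr_ge0. lra.
- move=> alpha beta ha hb ab; rewrite qualifE; apply/asboolP.
  have [k k0 dist_ge] := times_graph_dist3 ha hb ab.
  by exists k => //; near=> n; rewrite !ger0_norm ?exprn_ge0 //; near: n.
Unshelve. all: by end_near.
Qed.
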